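(* Let $n\ge 2$ and let $(s_1,\dots,s_p)$ and $(t_1,\dots,t_q)$ be normal sequences of simple $n$-braids. Let $\mathcal D$ be the grid with vertices $(i,j)$, $0\le i\le p$, $0\le j\le q$ (where $i$ increases from left to right and $j$ increases from top to bottom), whose horizontal edge from $(i-1,j)$ to $(i,j)$ is labelled by a simple braid $h_{i,j}$ ($1\le i\le p$, $0\le j\le q$) and whose vertical edge from $(i,j-1)$ to $(i,j)$ is labelled by a simple braid $v_{i,j}$ ($0\le i\le p$, $1\le j\le q$), the labels being determined as follows: the bottom row is $h_{i,q}=s_i$ for $1\le i\le p$, the left column is $v_{0,j}=t_j$ for $1\le j\le q$, and, filling from left to right and from bottom to top, each elementary rectangle is a $P$-tile, i.e., for $1\le i\le p$ and $1\le j\le q$, $$h_{i,j-1}\,v_{i,j}=v_{i-1,j}\,h_{i,j}\quad\text{and}\quad (h_{i,j-1},v_{i,j})\ \text{is normal}.$$ (i) Every path in $\mathcal D$ consisting of horizontal arrows followed by vertical arrows corresponds to a normal sequence (the sequence of labels of the successive arrows of the path, horizontal arrows being directed to the right and vertical arrows downwards). (ii) Let $x=s_1\cdots s_p$ and $y=t_1\cdots t_q$. Let $(s'_1,\dots,s'_p):=(h_{1,0},\dots,h_{p,0})$ be the top row of $\mathcal D$ and $(t'_1,\dots,t'_q):=(v_{p,1},\dots,v_{p,q})$ its right column. Then $(s'_1,\dots,s'_p,t'_1,\dots,t'_q)$ is the normal form of $yx$.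
   Context: $B_n$ is Artin's braid group with generators $\sigma_1,\dots,\sigma_{n-1}$ and relations $\sigma_i\sigma_j=\sigma_j\sigma_i$ for $|i-j|\ge2$, $\sigma_i\sigma_j\sigma_i=\sigma_j\sigma_i\sigma_j$ for $|i-j|=1$; $B_n^+$ is the submonoid generated by $\sigma_1,\dots,\sigma_{n-1}$ (positive braids). For $x,y\in B_n^+$, $x$ is a left (resp. right) divisor of $y$ if $y=xz$ (resp. $y=zx$) for some $z\in B_n^+$. $\Delta_n\in B_n^+$ is defined by $\Delta_1=1$, $\Delta_n=\sigma_1\sigma_2\cdots\sigma_{n-1}\Delta_{n-1}$. Simple braids are the left divisors of $\Delta_n$ in $B_n^+$ (which coincide with its right divisors). A sequence $(s_1,\dots,s_p)$ of simple braids is normal if, for each $k<p$, every $\sigma_i$ that is a left divisor of $s_{k+1}$ is a right divisor of $s_k$. Saying that $(s_1,\dots,s_p)$ is the normal form of a positive braid $x$ means that $(s_1,\dots,s_p)$ is normal and $x=s_1\cdots s_p$ (trailing entries equal to $1$ are allowed). For all simple $t_1,t_2$ there is a unique pair of simple braids $(s_1,s_2)$ that is normal and satisfies $s_1s_2=t_1t_2$ (namely $s_1$ is the greatest common left divisor of $t_1t_2$ and $\Delta_n$), so the grid is well defined. *)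

(* Defs.v *)
From HB Require Import structures.
From mathcomp Require Import all_boot.
From mathcomp Require Import boolp.

Set Implicit Arguments.
Unset Strict Implicit.
Unset Printing Implicit Defensive.

Local Open Scope group_scope.

(* A braid word on n strands is a word in the letters (i, e), where i : 'I_n.-1 *)
(* stands for the generator sigma_{i+1} if e = false, and for its inverse if    *)
(* e = true.  Indices are shifted by one with respect to the usual sigma_1, ... *)
Notation braid_word n := (seq ('I_n.-1 * bool)).

Inductive braid_relator (n : nat) : braid_word n -> braid_word n -> Prop :=
| BraidCancel (i : 'I_n.-1) (e : bool) :
    braid_relator [:: (i, e); (i, ~~ e)] [::]
| BraidFar (i j : 'I_n.-1) : (i.+2 <= j)%N || (j.+2 <= i)%N ->
    braid_relator [:: (i, false); (j, false)] [:: (j, false); (i, false)]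
| BraidNear (i j : 'I_n.-1) : (j == i.+1 :> nat) || (i == j.+1 :> nat) ->
    braid_relator [:: (i, false); (j, false); (i, false)]
                  [:: (j, false); (i, false); (j, false)].

Inductive braid_congr (n : nat) : braid_word n -> braid_word n -> Prop :=
| BraidRel (a b u v : braid_word n) :
    braid_relator u v -> braid_congr (a ++ u ++ b) (a ++ v ++ b)
| BraidRefl (u : braid_word n) : braid_congr u u
| BraidSym (u v : braid_word n) : braid_congr u v -> braid_congr v u
| BraidTrans (u v w : braid_word n) :
    braid_congr u v -> braid_congr v w -> braid_congr u w.

Definition braid_eqv (n : nat) (u v : braid_word n) : bool := `[< braid_congr u v >].

Lemma braid_eqv_refl n : reflexive (@braid_eqv n).
Proof. by move=> u; apply/asboolP/BraidRefl. Qed.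

Lemma braid_eqv_sym n : symmetric (@braid_eqv n).
Proof. by move=> u v; apply/asboolP/asboolP => /BraidSym. Qed.

Lemma braid_eqv_trans n : transitive (@braid_eqv n).
Proof.
by move=> v u w /asboolP uv /asboolP vw; apply/asboolP/(BraidTrans uv vw).
Qed.

Canonical braid_equiv_rel n :=
  EquivRel (@braid_eqv n) (@braid_eqv_refl n) (@braid_eqv_sym n)
           (@braid_eqv_trans n).

(* Artin's braid group B_n. *)
Definition braid (n : nat) : Type := {eq_quot @braid_eqv n}%qT.
HB.instance Definition _ n := Choice.on (braid n).
HB.instance Definition _ n := EqQuotient.on (braid n).

Section BraidGroup.
Variable n : nat.
Implicit Types (a b u v w : braid_word n) (x y z : braid n).

Definition braid_of u : braid n := (\pi_(braid n) u)%qT.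

Lemma braid_ofP u v : braid_of u = braid_of v <-> braid_congr u v.
Proof.
by split=> [/eqmodP/asboolP | uv] //; apply/eqmodP/asboolP.
Qed.

Lemma braid_of_repr x : braid_of (repr x) = x.
Proof. exact: reprK. Qed.

Lemma braid_congr_cat2 a b u v :
  braid_congr u v -> braid_congr (a ++ u ++ b) (a ++ v ++ b).
Proof.
elim=> {u v} [c d u v uv|u|u v _ /BraidSym//|u v w _ uv _ /(BraidTrans uv)//].
  by rewrite -!catA !(catA a c); apply: BraidRel.
exact: BraidRefl.
Qed.

Lemma braid_congr_cat u u' v v' :
  braid_congr u u' -> braid_congr v v' -> braid_congr (u ++ v) (u' ++ v').
Proof.
move=> uu' vv'; apply: (@BraidTrans _ _ (u' ++ v)).
  exact: (braid_congr_cat2 [::] v uu').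
by have := braid_congr_cat2 u' [::] vv'; rewrite !cats0.
Qed.

Definition braid_word_inv u : braid_word n := rev [seq (l.1, ~~ l.2) | l <- u].

Lemma braid_word_invK : involutive braid_word_inv.
Proof.
move=> u; rewrite /braid_word_inv map_rev revK -map_comp -[RHS]map_id.
by apply: eq_map => -[i e] /=; rewrite negbK.
Qed.

Lemma braid_word_mulV u : braid_congr (u ++ braid_word_inv u) [::].
Proof.
elim/last_ind: u => [|u [i e] IHu]; first exact: BraidRefl.
rewrite /braid_word_inv map_rcons rev_rcons -/(braid_word_inv u) cat_rcons.
by apply: BraidTrans (BraidRel u (braid_word_inv u) (BraidCancel i e)) _.
Qed.

Lemma braid_word_mulVl u : braid_congr (braid_word_inv u ++ u) [::].
Proof. by rewrite -{2}(braid_word_invK u); apply: braid_word_mulV. Qed.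

Definition braid_one : braid n := braid_of [::].
Definition braid_mul x y : braid n := braid_of (repr x ++ repr y).
Definition braid_inv x : braid n := braid_of (braid_word_inv (repr x)).

Lemma braid_mul_of u v : braid_mul (braid_of u) (braid_of v) = braid_of (u ++ v).
Proof.
by apply/braid_ofP/braid_congr_cat; apply/braid_ofP; rewrite braid_of_repr.
Qed.

Lemma braid_mulA : associative braid_mul.
Proof.
move=> x y z; rewrite -(braid_of_repr x) -(braid_of_repr y) -(braid_of_repr z).
by rewrite !braid_mul_of catA.
Qed.

Lemma braid_mul1 : left_id braid_one braid_mul.
Proof. by move=> x; rewrite -(braid_of_repr x) braid_mul_of. Qed.

Lemma braid_mulr1 : right_id braid_one braid_mul.
Proof. by move=> x; rewrite -(braid_of_repr x) braid_mul_of cats0. Qed.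

Lemma braid_mulV : left_inverse braid_one braid_inv braid_mul.
Proof.
move=> x; rewrite -{2}(braid_of_repr x) braid_mul_of.
exact/braid_ofP/braid_word_mulVl.
Qed.

Lemma braid_mulrV : right_inverse braid_one braid_inv braid_mul.
Proof.
move=> x; rewrite -{1}(braid_of_repr x) braid_mul_of.
exact/braid_ofP/braid_word_mulV.
Qed.

HB.instance Definition _ :=
  isGroup.Build (braid n) braid_mulA braid_mul1 braid_mulr1 braid_mulV braid_mulrV.

Definition sigma (i : 'I_n.-1) : braid n := braid_of [:: (i, false)].

(* The submonoid B_n^+ of B_n. *)
Inductive positive : braid n -> Prop :=
| Positive1 : positive 1
| PositiveSigma (i : 'I_n.-1) : positive (sigma i)
| PositiveM (x y : braid n) : positive x -> positive y -> positive (x * y).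

(* Divisibility in B_n^+; only meaningful for positive x and y. *)
Definition left_divisor x y : Prop := exists2 z, positive z & y = x * z.
Definition right_divisor x y : Prop := exists2 z, positive z & y = z * x.

(* Delta_m, for m <= n, seen in B_n: the product is sigma_1 ... sigma_{m-1}. *)
Fixpoint delta_rec (m : nat) : braid n :=
  if m is k.+1 then (\prod_(i < n.-1 | (i < k)%N) sigma i) * delta_rec k else 1.
Definition Delta : braid n := delta_rec n.

Definition simple x : Prop := positive x /\ left_divisor x Delta.

Definition normal (s : seq (braid n)) : Prop :=
  (forall x, x \in s -> simple x) /\
  (forall k, (k.+1 < size s)%N -> forall i : 'I_n.-1,
     left_divisor (sigma i) (nth 1 s k.+1) -> right_divisor (sigma i) (nth 1 s k)).

Definition normal_form (s : seq (braid n)) x : Prop :=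
  normal s /\ x = \prod_(y <- s) y.

End BraidGroup.

Section Grid.
Variable n : nat.

(* Edge labels of a grid with vertices (i, j): h i j labels the arrow from      *)
(* (i.-1, j) to (i, j), and v i j the arrow from (i, j.-1) to (i, j).           *)
Implicit Types h v : nat -> nat -> braid n.

(* Labels met along the path (i0, j) -> ... -> (i1, j), for i0 <= i1. *)
Definition hpath h (j i0 i1 : nat) : seq (braid n) :=
  [seq h i j | i <- index_iota i0.+1 i1.+1].

(* Labels met along the path (i, j0) -> ... -> (i, j1), for j0 <= j1. *)
Definition vpath v (i j0 j1 : nat) : seq (braid n) :=
  [seq v i j | j <- index_iota j0.+1 j1.+1].

Definition P_tile h v (i j : nat) : Prop :=
  h i j.-1 * v i j = v i.-1 j * h i j /\ normal [:: h i j.-1; v i j].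

Record P_grid (p q : nat) (s t : seq (braid n)) h v : Prop := PGrid {
  P_grid_hsimple : forall i j, (1 <= i <= p)%N -> (j <= q)%N -> simple (h i j);
  P_grid_vsimple : forall i j, (i <= p)%N -> (1 <= j <= q)%N -> simple (v i j);
  P_grid_bottom : hpath h q 0 p = s;
  P_grid_left : vpath v 0 0 q = t;
  P_grid_tile : forall i j, (1 <= i <= p)%N -> (1 <= j <= q)%N -> P_tile h v i j
}.

End Grid.

Lemma sigma_far n (i j : 'I_n.-1) :
  (i.+2 <= j)%N || (j.+2 <= i)%N -> sigma i * sigma j = sigma j * sigma i.
Proof.
move=> ij; rewrite /sigma [LHS]braid_mul_of [RHS]braid_mul_of; apply/braid_ofP.
exact: (BraidRel [::] [::] (BraidFar ij)).
Qed.

Lemma sigma_near n (i j : 'I_n.-1) :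
  (j == i.+1 :> nat) || (i == j.+1 :> nat) ->
  sigma i * sigma j * sigma i = sigma j * sigma i * sigma j.
Proof.
move=> ij; rewrite /sigma /mul /= !braid_mul_of; apply/braid_ofP.
exact: (BraidRel [::] [::] (BraidNear ij)).
Qed.

(* Main.v *)
Require Import Defs.
From HB Require Import structures.
From mathcomp Require Import all_boot.
From mathcomp Require Import boolp.
From mathcomp Require Import zify.

Set Implicit Arguments.
Unset Strict Implicit.
Unset Printing Implicit Defensive.

Local Open Scope group_scope.

(** The grid is filled by P-tiles, and normality of its paths propagates from
    tile to tile by two domino rules.  If two horizontally adjacent tiles have a
    normal bottom side, then their top side is normal ([domino_row]): an atom
    sigma that begins the second top label extends the first one to a divisor of
    the whole word, and greediness of the bottom side forces that extension to
    lie already inside the first tile.  If two vertically adjacent tiles have a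
    normal left side, then their right side is normal ([domino_column]): the
    middle horizontal label is a left lcm of two elements which a would-be bad
    atom sigma extends on the right to simple elements, so sigma also extends
    the middle label, against the normality of the lower tile.  Starting from
    the bottom row and the left column, all rows and columns of the grid are
    normal, and the corner of a path is normal because it is the corner of a
    tile.  Part (ii) adds that the tile relations make both ways around the
    rectangle spell the same braid.

    The domino rules rest on four facts of Garside theory in the group B_n.
    - Common divisors: any two common left divisors of x and y divide a third
      one ([ldiv_directed]), and symmetrically on the right ([rdiv_directed]).
    - Left and right divisors of Delta coincide ([ldiv_rdiv_Delta]).
    - No simple braid contains the square of an atom ([square_free]).  This is
      what turns the normality condition into maximality of the left factor
      ([greedy_head], [greedy_mull]).
    - A simple braid that cannot be extended on the right by sigma inside Delta
      ends with sigma ([exchange]).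

    The first fact comes from the analogous statement for two atoms
    ([sigma_lcm]), a statement on positive braids inside the group.  Equality in
    B_n of positive words allows inverses in intermediate steps, so it is first
    proved for the monoid with the same presentation ([gen_lcm], Garside's
    lemma), and then transported: the monoid is left cancellative and its full
    twist is central and divisible by all generators, so that every signed word
    is a fraction over a power of the full twist, and the monoid embeds in B_n
    ([pos_word_congr]). *)

(** * The braid monoid and Garside's lemma *)

Definition far (i j : nat) : bool := (i.+2 <= j) || (j.+2 <= i).
Definition near (i j : nat) : bool := (j == i.+1) || (i == j.+1).

Lemma farC i j : far i j = far j i. Proof. by rewrite /far orbC. Qed.
Lemma nearC i j : near i j = near j i. Proof. by rewrite /near orbC. Qed.

(** Two generators are equal, commute, or satisfy the length-three relation, and
    exactly one of these holds; [genP] is the corresponding case analysis. *)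
Variant gen_spec N (i j : 'I_N) : bool -> bool -> bool -> Type :=
| GenEq of i = j : gen_spec i j true false false
| GenFar of far i j : gen_spec i j false true false
| GenNear of near i j : gen_spec i j false false true.

Lemma genP N (i j : 'I_N) : gen_spec i j (i == j) (far i j) (near i j).
Proof.
have -> : (i == j) = (i == j :> nat) by [].
have [ij | ij] := eqVneq (i : nat) j.
  have -> : far i j = false by rewrite /far; lia.
  have -> : near i j = false by rewrite /near; lia.
  by apply: GenEq; apply: val_inj.
case fij: (far i j).
  have -> : near i j = false by move: fij; rewrite /far /near; lia.
  exact: GenFar.
have nij : near i j by move: fij ij; rewrite /far /near; lia.
by rewrite nij; apply: GenNear.
Qed.

Lemma far_neq N (i j : 'I_N) : far i j -> (i == j) = false.
Proof. by rewrite /far -val_eqE /=; lia. Qed.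

Lemma near_neq N (i j : 'I_N) : near i j -> (i == j) = false.
Proof. by rewrite /near -val_eqE /=; lia. Qed.

Lemma near_far i j : near i j -> far i j = false.
Proof. by rewrite /near /far; lia. Qed.

Inductive pos_relator N : seq 'I_N -> seq 'I_N -> Prop :=
| PosFar (i j : 'I_N) : far i j -> pos_relator [:: i; j] [:: j; i]
| PosNear (i j : 'I_N) : near i j -> pos_relator [:: i; j; i] [:: j; i; j].

Inductive pos_congr N : seq 'I_N -> seq 'I_N -> Prop :=
| PosRel (a b u v : seq 'I_N) :
    pos_relator u v -> pos_congr (a ++ u ++ b) (a ++ v ++ b)
| PosRefl (u : seq 'I_N) : pos_congr u u
| PosSym (u v : seq 'I_N) : pos_congr u v -> pos_congr v u
| PosTrans (u v w : seq 'I_N) : pos_congr u v -> pos_congr v w -> pos_congr u w.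

Definition pos_eqv N (u v : seq 'I_N) : bool := `[< pos_congr u v >].

Lemma pos_eqv_refl N : reflexive (@pos_eqv N).
Proof. by move=> u; apply/asboolP/PosRefl. Qed.

Lemma pos_eqv_sym N : symmetric (@pos_eqv N).
Proof. by move=> u v; apply/asboolP/asboolP => /PosSym. Qed.

Lemma pos_eqv_trans N : transitive (@pos_eqv N).
Proof. by move=> v u w /asboolP uv /asboolP vw; apply/asboolP/(PosTrans uv vw). Qed.

Canonical pos_equiv_rel N :=
  EquivRel (@pos_eqv N) (@pos_eqv_refl N) (@pos_eqv_sym N) (@pos_eqv_trans N).

(** The monoid presented by N generators and the braid relations.  Its image in
    the braid group is the submonoid of positive braids, but that the map is
    injective is a theorem ([pos_word_congr]), not a definition. *)
Definition braid_monoid (N : nat) : Type := {eq_quot @pos_eqv N}%qT.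
HB.instance Definition _ N := Choice.on (braid_monoid N).
HB.instance Definition _ N := EqQuotient.on (braid_monoid N).

Section BraidMonoid.
Variable N : nat.
Implicit Types (a b u v w : seq 'I_N) (x y z : braid_monoid N) (i j k : 'I_N).

Definition bmon_of u : braid_monoid N := (\pi_(braid_monoid N) u)%qT.

Lemma bmon_ofP u v : bmon_of u = bmon_of v <-> pos_congr u v.
Proof. by split=> [/eqmodP/asboolP | uv] //; apply/eqmodP/asboolP. Qed.

Lemma bmon_of_repr x : bmon_of (repr x) = x.
Proof. exact: reprK. Qed.

Lemma pos_congr_cat2 a b u v : pos_congr u v -> pos_congr (a ++ u ++ b) (a ++ v ++ b).
Proof.
elim=> {u v} [c d u v uv|u|u v _ /PosSym//|u v w _ uv _ /(PosTrans uv)//].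
  by rewrite -!catA !(catA a c); apply: PosRel.
exact: PosRefl.
Qed.

Definition bmon_mul x y : braid_monoid N := bmon_of (repr x ++ repr y).

Lemma bmon_mul_of u v : bmon_mul (bmon_of u) (bmon_of v) = bmon_of (u ++ v).
Proof.
apply/bmon_ofP; have eqr w : pos_congr (repr (bmon_of w)) w.
  by apply/bmon_ofP; rewrite bmon_of_repr.
apply: PosTrans (pos_congr_cat2 [::] (repr (bmon_of v)) (eqr u)) _.
by have := pos_congr_cat2 u [::] (eqr v); rewrite !cats0.
Qed.

Lemma bmon_mulA : associative bmon_mul.
Proof.
move=> x y z; rewrite -(bmon_of_repr x) -(bmon_of_repr y) -(bmon_of_repr z).
by rewrite !bmon_mul_of catA.
Qed.

Lemma bmon_mul1 : left_id (bmon_of [::]) bmon_mul.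
Proof. by move=> x; rewrite -(bmon_of_repr x) bmon_mul_of. Qed.

Lemma bmon_mulr1 : right_id (bmon_of [::]) bmon_mul.
Proof. by move=> x; rewrite -(bmon_of_repr x) bmon_mul_of cats0. Qed.

HB.instance Definition _ :=
  isMonoid.Build (braid_monoid N) bmon_mulA bmon_mul1 bmon_mulr1.

Definition gen i : braid_monoid N := bmon_of [:: i].

Lemma bmon_of_cons i u : bmon_of (i :: u) = gen i * bmon_of u.
Proof. by rewrite /gen [RHS]bmon_mul_of. Qed.

Lemma bmon_of_cat u v : bmon_of (u ++ v) = bmon_of u * bmon_of v.
Proof. by rewrite [RHS]bmon_mul_of. Qed.

(** These relations carry a trailing factor x so that they rewrite inside
    products associated to the right. *)
Lemma gen_far i j x : far i j -> gen i * (gen j * x) = gen j * (gen i * x).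
Proof.
move=> ij; rewrite -(bmon_of_repr x) -!bmon_of_cons; apply/bmon_ofP.
exact: (PosRel [::] _ (PosFar ij)).
Qed.

Lemma gen_near i j x :
  near i j -> gen i * (gen j * (gen i * x)) = gen j * (gen i * (gen j * x)).
Proof.
move=> ij; rewrite -(bmon_of_repr x) -!bmon_of_cons; apply/bmon_ofP.
exact: (PosRel [::] _ (PosNear ij)).
Qed.

Lemma pos_congr_size u v : pos_congr u v -> size u = size v.
Proof.
by elim=> {u v} [a b u v [i j|i j] _|//|//|u v w _ -> _ ->//]; rewrite !size_cat.
Qed.

Definition monoid_length x : nat := size (repr x).

Lemma monoid_length_of u : monoid_length (bmon_of u) = size u.
Proof. by apply/pos_congr_size/bmon_ofP; rewrite bmon_of_repr. Qed.

Lemma monoid_lengthM x y : monoid_length (x * y) = monoid_length x + monoid_length y.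
Proof. by rewrite monoid_length_of size_cat. Qed.

Lemma monoid_length_gen i : monoid_length (gen i) = 1%N. Proof. exact: monoid_length_of. Qed.

(** The complement of gen i in the right lcm of gen i and gen j: that lcm is
    both gen i * gen_compl i j and gen j * gen_compl j i. *)
Definition gen_compl i j : braid_monoid N :=
  if i == j then 1 else if far i j then gen j else gen j * gen i.

Definition lcm_cofactors i j x y := exists z, x = gen_compl i j * z /\ y = gen_compl j i * z.

Lemma lcm_cofactors_sym i j x y : lcm_cofactors i j x y -> lcm_cofactors j i y x.
Proof. by case=> z [-> ->]; exists z. Qed.

Lemma lcm_cofactors_eq i x y : lcm_cofactors i i x y <-> x = y.
Proof.
rewrite /lcm_cofactors /gen_compl eqxx; split=> [[z [-> ->]]//|->].
by exists y; rewrite mul1g.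
Qed.

Lemma lcm_cofactors_far i j x y : far i j ->
  lcm_cofactors i j x y <-> exists z, x = gen j * z /\ y = gen i * z.
Proof.
move=> fij; rewrite /lcm_cofactors /gen_compl fij [far j i]farC fij.
by rewrite [j == i]eq_sym far_neq.
Qed.

Lemma lcm_cofactors_near i j x y : near i j ->
  lcm_cofactors i j x y <-> exists z, x = gen j * (gen i * z) /\ y = gen i * (gen j * z).
Proof.
move=> nij; rewrite /lcm_cofactors /gen_compl [far j i]farC [j == i]eq_sym.
rewrite near_neq // near_far //.
by split=> -[z [-> ->]]; exists z; rewrite !mulgA.
Qed.

(** Garside's lemma is proved by induction on the length.  Inside this section it
    is assumed for words with a tail shorter than L; what has to be shown is that
    the relation [lcm_cofactors] is then transitive one level up. *)
Section Cube.
Variable L : nat.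
Hypothesis IH : forall i j x y,
  monoid_length x < L -> gen i * x = gen j * y -> lcm_cofactors i j x y.

Let IHeq i x y : monoid_length x < L -> gen i * x = gen i * y -> x = y.
Proof. by move=> xL /(IH xL)/lcm_cofactors_eq. Qed.

Let IHfar i j x y : far i j -> monoid_length x < L -> gen i * x = gen j * y ->
  exists z, x = gen j * z /\ y = gen i * z.
Proof. by move=> fij xL /(IH xL)/(lcm_cofactors_far _ _ fij). Qed.

Let IHnear i j x y : near i j -> monoid_length x < L -> gen i * x = gen j * y ->
  exists z, x = gen j * (gen i * z) /\ y = gen i * (gen j * z).
Proof. by move=> nij xL /(IH xL)/(lcm_cofactors_near _ _ nij). Qed.

(** The mixed case of the cube condition: either i is far from both other
    generators, or j is the middle one of three consecutive generators. *)
Lemma cube_condition_far_near i j k x y z :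
  far i k -> near k j -> i != j -> monoid_length z <= L ->
  lcm_cofactors i k x z -> lcm_cofactors k j z y -> lcm_cofactors i j x y.
Proof.
move=> fik nkj ij zL /(lcm_cofactors_far _ _ fik)[w [xE zE]].
move=> /(lcm_cofactors_near _ _ nkj)[w' [zE' yE]]; subst x y.
have wL : monoid_length w < L by move: zL; rewrite zE monoid_lengthM monoid_length_gen; lia.
have w'L : monoid_length w' + 1 < L.
  by move: zL; rewrite zE' !monoid_lengthM !monoid_length_gen; lia.
have eqw : gen i * w = gen j * (gen k * w') by rewrite -zE -zE'.
have fki : far k i by rewrite farC.
case: (genP i j) ij => // [fij|nij] _.
- have [a [wa w'a]] := IHfar fij wL eqw.
  have [|b [w'b ab]] := IHfar fki _ w'a; first lia.
  subst; apply/(lcm_cofactors_far _ _ fij); exists (gen k * (gen j * b)).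
  rewrite (gen_near _ nkj); split=> //.
  by rewrite [in RHS]gen_far // [gen i * (gen j * b)]gen_far.
have [a [wa w'a]] := IHnear nij wL eqw.
have [|b [w'b ab]] := IHfar fki _ w'a; first lia.
have njk : near j k by rewrite nearC.
have [|c [ac bc]] := IHnear njk _ ab.
  by move: wL; rewrite wa !monoid_lengthM !monoid_length_gen; lia.
have nji : near j i by rewrite nearC.
(* The witness completes the lcm of gen i and gen j, which is their half twist on
   three strands, to the half twist on the four strands of i, j and k. *)
subst; apply/(lcm_cofactors_near _ _ nij); exists (gen k * (gen j * (gen i * c))); split.
  by rewrite (gen_far (gen j * c) fik) (gen_near (gen i * (gen j * c)) nkj)
             (gen_near c nji) (gen_far (gen j * (gen i * c)) fki).
by rewrite (gen_near (gen k * c) nji) (gen_far (gen j * (gen i * (gen k * c))) fki)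
           (gen_far c fik) (gen_near (gen i * c) nkj).
Qed.

(** The cube condition.  Two successive changes of first letter, i to k and k to
    j, share the tail z; applying the lemma for shorter words to z yields a
    common right multiple of the three generators, from which the direct change
    i to j is read off.  No three generators are pairwise adjacent, which leaves
    only the cases below. *)
Lemma cube_condition i j k x y z : monoid_length z <= L ->
  lcm_cofactors i k x z -> lcm_cofactors k j z y -> lcm_cofactors i j x y.
Proof.
move=> zL mik mkj; case: (eqVneq i j) mkj => [<-{j} | ij] mkj.
  apply/lcm_cofactors_eq; case: (genP i k) mik mkj => [<-|fik|nik].
  - by move=> /lcm_cofactors_eq-> /lcm_cofactors_eq.
  - have fki : far k i by rewrite farC.
    move=> /(lcm_cofactors_far _ _ fik)[w [-> zE]] /(lcm_cofactors_far _ _ fki)[w' [zE' ->]].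
    congr (_ * _); apply: (@IHeq i); last by rewrite -zE.
    by move: zL; rewrite zE monoid_lengthM monoid_length_gen; lia.
  have nki : near k i by rewrite nearC.
  move=> /(lcm_cofactors_near _ _ nik)[w [-> zE]] /(lcm_cofactors_near _ _ nki)[w' [zE' ->]].
  congr (_ * (_ * _)); apply: (@IHeq k); last apply: (@IHeq i); last by rewrite -zE.
    by move: zL; rewrite zE !monoid_lengthM !monoid_length_gen; lia.
  by move: zL; rewrite zE !monoid_lengthM !monoid_length_gen; lia.
case: (genP i k) mik => [ik|fik|nik] mik.
- by subst k; move/lcm_cofactors_eq: mik => ->.
- case: (genP k j) mkj => [kj|fkj|nkj] mkj; last exact: cube_condition_far_near mkj.
    by subst j; move/lcm_cofactors_eq: mkj => <-.
  move: mik mkj => /(lcm_cofactors_far _ _ fik)[w [-> zE]].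
  move=> /(lcm_cofactors_far _ _ fkj)[w' [zE' ->]].
  have fki : far k i by rewrite farC.
  have /IH[|a [-> ->]] : gen i * w = gen j * w' by rewrite -zE.
    by move: zL; rewrite zE monoid_lengthM monoid_length_gen; lia.
  exists (gen k * a); rewrite /gen_compl [j == i]eq_sym (negPf ij) (farC j).
  case: (far i j); first by split; apply: gen_far; rewrite // farC.
  rewrite -!mulgA; split.
    by rewrite (gen_far (gen i * a) fkj) (gen_far a fki).
  by rewrite (gen_far (gen j * a) fki) (gen_far a fkj).
case: (genP k j) mkj => [kj|fkj|nkj] mkj; first by subst j; move/lcm_cofactors_eq: mkj => <-.
  apply: lcm_cofactors_sym.
  apply: (@cube_condition_far_near _ _ k)
         (lcm_cofactors_sym mkj) (lcm_cofactors_sym mik) => //.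
  - by rewrite farC.
  - by rewrite nearC.
  - by rewrite eq_sym.
(* k is adjacent to both i and j, hence lies between them. *)
have fij : far i j by move: nik nkj ij; rewrite /far /near -val_eqE /=; lia.
have nki : near k i by rewrite nearC.
have njk : near j k by rewrite nearC.
move: mik mkj => /(lcm_cofactors_near _ _ nik)[w [-> zE]].
move=> /(lcm_cofactors_near _ _ nkj)[w' [zE' ->]].
have wL : monoid_length w + 2 <= L.
  by move: zL; rewrite zE !monoid_lengthM !monoid_length_gen; lia.
have w'L : monoid_length w' + 2 <= L.
  by move: zL; rewrite zE' !monoid_lengthM !monoid_length_gen; lia.
have [|z1 [kw kw']] := IHfar fij _ (etrans (esym zE) zE').
  by rewrite monoid_lengthM monoid_length_gen; lia.
have [|y1 [wE z1E]] := IHnear nkj _ kw; first lia.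
have [|y2 [w'E z1E']] := IHnear nki _ kw'; first lia.
have z1L : monoid_length z1 + 1 < L.
  have := congr1 monoid_length kw; rewrite !monoid_lengthM !monoid_length_gen; lia.
have fji : far j i by rewrite farC.
have := IHeq _ (etrans (esym z1E) z1E'); rewrite monoid_lengthM monoid_length_gen => y12.
have [||c [y1E y2E]] := IHfar fji _ (y12 _).
- by move: z1L; rewrite z1E !monoid_lengthM !monoid_length_gen; lia.
- by move: z1L; rewrite z1E !monoid_lengthM !monoid_length_gen; lia.
subst; apply/(lcm_cofactors_far _ _ fij).
exists (gen k * (gen j * (gen i * (gen k * c)))); split.
  by rewrite (gen_far (gen k * (gen i * c)) fij) (gen_near c nik)
             (gen_near (gen i * (gen k * c)) nkj).
by rewrite (gen_far (gen k * (gen j * c)) fji) (gen_near c njk)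
           (gen_near (gen j * (gen k * c)) nki) (gen_far (gen k * c) fij).
Qed.

End Cube.

(** Garside's lemma: a common right multiple of two generators is a multiple of
    their lcm.  A congruence of words is a chain of elementary steps.  Each step
    either acts away from the first letter, or replaces it and exhibits the lcm;
    by the cube condition these one-step conclusions compose along the chain. *)
Lemma gen_lcm i j x y : gen i * x = gen j * y -> lcm_cofactors i j x y.
Proof.
have [L] := ubnP (monoid_length x); elim: L => // L IHL in i j x y *.
rewrite ltnS => xL.
suff main u v : pos_congr u v -> (size u <= L.+1)%N -> forall i j u' v',
    u = i :: u' -> v = j :: v' -> lcm_cofactors i j (bmon_of u') (bmon_of v').
  rewrite -(bmon_of_repr x) -(bmon_of_repr y) -!bmon_of_cons => /bmon_ofP eq_uv.
  exact: (main _ _ eq_uv).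
elim=> {u v} [a b u v uv|u|u v uv IH|u v w uv IHuv vw IHvw] sz {}i {}j u' v'.
- case: a sz => [|k a] _ /=; last first.
    move=> [<- <-] [<- <-]; apply/lcm_cofactors_eq/bmon_ofP; exact: PosRel.
  case: uv => {}i' {}j' ij [<- <-] [<- <-].
    by apply/(lcm_cofactors_far _ _ ij); exists (bmon_of b); rewrite -!bmon_of_cons.
  by apply/(lcm_cofactors_near _ _ ij); exists (bmon_of b); rewrite -!bmon_of_cons.
- by move=> -> [-> ->]; apply/lcm_cofactors_eq.
- move=> uE vE; apply: lcm_cofactors_sym; apply: IH vE uE.
  by rewrite (pos_congr_size uv).
- case: v IHuv IHvw uv vw => [|k z] IHuv IHvw uv vw uE wE.
    by have := pos_congr_size uv; rewrite uE.
  have szv : (size z <= L)%N by have := pos_congr_size uv => /= szv; rewrite szv in sz.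
  apply: (cube_condition IHL) (IHuv sz _ _ _ _ uE erefl) (IHvw szv _ _ _ _ erefl wE) => //.
  by rewrite monoid_length_of.
Qed.

Lemma bmon_ind (P : braid_monoid N -> Prop) :
  P 1 -> (forall i x, P x -> P (gen i * x)) -> forall x, P x.
Proof.
move=> P1 PS x; rewrite -(bmon_of_repr x).
by elim: (repr x) => [|i u IHu] //; rewrite bmon_of_cons; apply: PS.
Qed.

Lemma bmon_mulI x y z : x * y = x * z -> y = z.
Proof.
elim/bmon_ind: x y z => [|i x IHx] y z; first by rewrite !mul1g.
by rewrite -!mulgA => /gen_lcm/lcm_cofactors_eq/IHx.
Qed.

End BraidMonoid.

(** * The half twist in a monoid satisfying the braid relations *)

(** The computations with the half twist are needed twice, in the braid monoid and
    in the braid group.  The generators on N.+1 strands are s 0, ..., s N.-1; the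
    other s i only have to satisfy the far commutations. *)
Section HalfTwist.
Variables (T : monoidType) (N : nat) (s : nat -> T).
Hypothesis s_far : forall i j, far i j -> s i * s j = s j * s i.
Hypothesis s_near : forall i, (i.+1 < N)%N ->
  s i * s i.+1 * s i = s i.+1 * s i * s i.+1.

Fixpoint ascend k : T := if k is k'.+1 then ascend k' * s k' else 1.
Fixpoint half_twist m : T := if m is k.+1 then ascend k * half_twist k else 1.

Lemma ascend_comm j k : (k < j)%N -> s j * ascend k = ascend k * s j.
Proof.
elim: k => [|k IHk] kj /=; first by rewrite mulg1 mul1g.
by rewrite mulgA IHk 1?ltnW // -!mulgA s_far // /far kj orbT.
Qed.

Lemma half_twist_comm j m : (m <= j)%N -> s j * half_twist m = half_twist m * s j.
Proof.
elim: m => [|m IHm] mj /=; first by rewrite mulg1 mul1g.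
by rewrite mulgA ascend_comm // -!mulgA IHm // ltnW.
Qed.

(** Sliding a crossing through the strand that travels across all the others moves
    it by one position. *)
Lemma ascend_shift i k : (i.+1 < k)%N -> (k <= N)%N -> s i.+1 * ascend k = ascend k * s i.
Proof.
elim: k => // k IHk; rewrite ltnS leq_eqVlt => /predU1P[<-{k IHk} iN /= | ik kN /=].
  by rewrite !mulgA ascend_comm // -!mulgA; congr (_ * _); rewrite !mulgA s_near.
by rewrite mulgA IHk // 1?ltnW // -!mulgA s_far // /far ik.
Qed.

Lemma ascend_ascend j k : (j <= k)%N -> (k < N)%N ->
  s 0 * ascend k.+1 * ascend j = ascend j.+1 * ascend k.+1.
Proof.
move=> jk kN; elim: j jk => [|j IHj] jk; first by rewrite /= mulg1 mul1g.
rewrite [ascend j.+1]/= mulgA IHj 1?ltnW // -[in LHS]mulgA -ascend_shift ?ltnS //.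
by rewrite !mulgA.
Qed.

(** Turning m strands upside down exchanges the generators i and m - 2 - i. *)
Lemma half_twist_flip i j m : (m <= N.+1)%N -> (i + j).+2 = m ->
  s i * half_twist m = half_twist m * s j.
Proof.
elim: m i => // m IHm [|i] mN ijm; last first.
  rewrite [half_twist m.+1]/= mulgA ascend_shift; [|by lia..].
  by rewrite -!mulgA IHm //; lia.
(* For i = 0 the crossing does not slide through the first strand; expanding two
   levels of the half twist leaves the square of ascend j.+1 on both sides. *)
have mE : m = j.+1 by lia.
rewrite {}mE in mN *; rewrite /= !mulgA -[RHS]mulgA -half_twist_comm //.
by have := ascend_ascend (leqnn j) mN; rewrite /= !mulgA => ->.
Qed.

(** The cofactor is kept inside an arbitrary submonoid P containing the s j: in the
    braid group it has to be a positive braid. *)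
Lemma half_twist_gen (P : T -> Prop) i m :
  P 1 -> (forall j, P (s j)) -> (forall x y, P x -> P y -> P (x * y)) ->
  (m <= N.+1)%N -> (i.+1 < m)%N -> exists2 c, P c & half_twist m = s i * c.
Proof.
move=> P1 Ps PM; have Pasc k : P (ascend k) by elim: k => //= k IHk; apply: PM.
have Pht k : P (half_twist k) by elim: k => //= k IHk; apply: PM.
have asc0 k : exists2 c, P c & ascend k.+1 = s 0 * c.
  elim: k => [|k [c Pc IHk]]; first by exists 1; rewrite //= mul1g mulg1.
  by exists (c * s k.+1); [apply: PM | rewrite mulgA -IHk].
have dS k : half_twist k.+1 = ascend k * half_twist k by [].
elim: m i => // m IHm [|i] mN; rewrite ltnS => im; rewrite dS.
  case: m im {IHm mN} => // m _; have [c Pc ->] := asc0 m.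
  by exists (c * half_twist m.+1); [apply: PM | rewrite -mulgA].
have [|c Pc ->] := IHm i _ im; first exact: ltnW.
by exists (ascend m * c); [apply: PM | rewrite !mulgA ascend_shift].
Qed.

Lemma full_twist_comm i : (i < N)%N ->
  s i * (half_twist N.+1 * half_twist N.+1) = half_twist N.+1 * half_twist N.+1 * s i.
Proof.
move=> iN; have e : (i + (N - i.+1)).+2 = N.+1 by lia.
have e' : ((N - i.+1) + i).+2 = N.+1 by lia.
move: (half_twist_flip (leqnn _) e) (half_twist_flip (leqnn _) e').
by move: (half_twist N.+1) => D De De'; rewrite mulgA De -!mulgA De'.
Qed.

End HalfTwist.

(** * The braid monoid embeds in the braid group *)

Section Embedding.
Variable n : nat.
Local Notation N := n.-1.
Implicit Types (i j k : 'I_N) (u v w : seq 'I_N).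

(** The value 1 outside the range keeps all far commutations valid, so that indices
    can be natural numbers. *)
Definition gen_nat (k : nat) : braid_monoid N := if insub k is Some i then gen i else 1.

Lemma gen_natE i : gen_nat i = gen i.
Proof. by rewrite /gen_nat valK. Qed.

Lemma gen_nat_far (k l : nat) : far k l -> gen_nat k * gen_nat l = gen_nat l * gen_nat k.
Proof.
move=> kl; rewrite /gen_nat.
case: insubP => [i _ ik|_]; case: insubP => [j _ jl|_]; rewrite ?mul1g ?mulg1 //.
by have := @gen_far N i j 1; rewrite !mulg1 ik jl; apply.
Qed.

Lemma gen_nat_near (k : nat) : (k.+1 < N)%N ->
  gen_nat k * gen_nat k.+1 * gen_nat k = gen_nat k.+1 * gen_nat k * gen_nat k.+1.
Proof.
move=> kN; have := @gen_near N (Ordinal (ltnW kN)) (Ordinal kN) 1.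
rewrite /near eqxx -!gen_natE /= !mulg1 !mulgA; exact.
Qed.

Definition full_twist : braid_monoid N :=
  half_twist gen_nat N.+1 * half_twist gen_nat N.+1.

Lemma full_twistC x : full_twist * x = x * full_twist.
Proof.
elim/bmon_ind: x => [|i x IHx]; first by rewrite mulg1 mul1g.
rewrite mulgA -gen_natE -(full_twist_comm gen_nat_far gen_nat_near) //.
by rewrite -mulgA IHx mulgA.
Qed.

Lemma full_twistXC m x : full_twist ^+ m * x = x * full_twist ^+ m.
Proof. by apply/esym/commuteX; rewrite /commute full_twistC. Qed.

Lemma gen_cofactor :
  exists c, forall i, gen i * c i = full_twist /\ c i * gen i = full_twist.
Proof.
suff /choice[c cP] : forall i, exists c, gen i * c = full_twist.
  exists c => i; split=> //; apply: (@bmon_mulI _ (gen i)).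
  by rewrite mulgA cP full_twistC.
move=> i; have iN : (i.+1 < N.+1)%N by rewrite ltnS.
have [//|//|//|c _ cP] :=
  half_twist_gen gen_nat_far gen_nat_near (P := fun=> True) _ _ _ (leqnn _) iN.
by exists (c * half_twist gen_nat N.+1); rewrite mulgA -gen_natE -cP.
Qed.

(** The inverse of a generator i is c i over the full twist, so a signed word w
    stands for the fraction of numerator numer w and of denominator the power
    denom_exp w of the full twist. *)
Section Fractions.
Variable c : 'I_N -> braid_monoid N.
Hypothesis cP : forall i, gen i * c i = full_twist /\ c i * gen i = full_twist.

Definition numer (w : braid_word n) : braid_monoid N :=
  \prod_(l <- w) (if l.2 then c l.1 else gen l.1).
Definition denom_exp (w : braid_word n) : nat := count snd w.

(** Congruent signed words have equal fractions: since the full twist is central and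
    can be cancelled, cross multiplication is an equivalence relation compatible
    with concatenation, and it identifies both sides of each relator. *)
Lemma numer_congr (u v : braid_word n) : braid_congr u v ->
  full_twist ^+ denom_exp v * numer u = full_twist ^+ denom_exp u * numer v.
Proof.
have OC := full_twistXC; elim=> {u v} [a b u v uv|//|//|u v w _ uv _ vw]; last first.
  apply: (@bmon_mulI _ (full_twist ^+ denom_exp v)).
  rewrite mulgA (OC _ (full_twist ^+ denom_exp w)) -mulgA uv.
  rewrite mulgA (OC _ (full_twist ^+ denom_exp u)) -mulgA vw !mulgA.
  by congr (_ * _); rewrite OC.
have shift x y z (k l m : nat) : full_twist ^+ (k + (l + m)) * (x * (y * z)) =
    full_twist ^+ (k + m) * (x * (full_twist ^+ l * y * z)).
  rewrite (addnC l) addnA expgnDr -mulgA; congr (_ * _).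
  by rewrite !mulgA OC.
have numer_cat (w w' : braid_word n) : numer (w ++ w') = numer w * numer w'.
  by rewrite /numer big_cat.
have denom_cat (w w' : braid_word n) :
    denom_exp (w ++ w') = (denom_exp w + denom_exp w')%N.
  by rewrite /denom_exp count_cat.
rewrite !denom_cat !numer_cat !shift.
congr (_ * (_ * (_ * _))).
case: uv => [i e|i j ij|i j ij]; rewrite /numer !big_cons big_nil ?mulg1 /=.
- by case: e; rewrite /denom_exp /= expg0 mul1g expg1 ?mulg1; case: (cP i).
- by have := gen_far 1 ij; rewrite !mulg1 => ->.
by have := gen_near 1 ij; rewrite !mulg1 => ->.
Qed.

End Fractions.

Definition pos_word (u : seq 'I_N) : braid_word n := [seq (i, false) | i <- u].

(** The fraction of a positive word has denominator 1, so congruence of signed words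
    gives back congruence in the monoid. *)
Lemma pos_word_congr u v : braid_congr (pos_word u) (pos_word v) <-> pos_congr u v.
Proof.
split=> [|uv].
  have [c cP] := gen_cofactor; move=> /(numer_congr cP).
  have dE w : denom_exp (pos_word w) = 0 by rewrite /denom_exp count_map count_pred0.
  have nE w : numer c (pos_word w) = bmon_of w.
    rewrite /numer; elim: w => [|i w IHw]; first by rewrite big_nil.
    by rewrite /= big_cons IHw bmon_of_cons.
  by rewrite !dE !nE !mul1g => /bmon_ofP.
elim: uv => {u v} [a b u v uv|u|u v _ /BraidSym//|u v w _ uv _ /(BraidTrans uv)//].
  rewrite /pos_word !map_cat; apply: BraidRel.
  by case: uv => i j ij; constructor.
exact: BraidRefl.
Qed.

Definition pos_braid u : braid n := \prod_(i <- u) sigma i.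

Lemma pos_braidE u : pos_braid u = braid_of (pos_word u).
Proof.
rewrite /pos_braid; elim: u => [|i u IHu]; first by rewrite big_nil.
by rewrite big_cons IHu [LHS]braid_mul_of.
Qed.

Lemma pos_braid_eq u v : pos_braid u = pos_braid v <-> pos_congr u v.
Proof. by rewrite !pos_braidE braid_ofP pos_word_congr. Qed.

Lemma positiveP (x : braid n) : positive x <-> exists u, x = pos_braid u.
Proof.
split=> [|[u ->]].
  elim=> [|i|_ _ _ [u ->] _ [v ->]]; first by exists [::]; rewrite /pos_braid big_nil.
    by exists [:: i]; rewrite /pos_braid big_seq1.
  by exists (u ++ v); rewrite /pos_braid big_cat.
elim: u => [|i u IHu]; first by rewrite /pos_braid big_nil; apply: Positive1.
by rewrite /pos_braid big_cons; apply/PositiveM/IHu/PositiveSigma.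
Qed.

End Embedding.

(** * Divisibility of positive braids *)

Section Divisibility.
Variable n : nat.
Local Notation N := n.-1.
Implicit Types (i j k : 'I_N) (u v w : seq 'I_N) (x y z a b c l : braid n).
Local Notation ldiv := (@left_divisor n).
Local Notation rdiv := (@right_divisor n).
Local Notation pos := (@positive n).

Lemma pos_braid_cons i u : pos_braid (i :: u) = sigma i * pos_braid u.
Proof. by rewrite /pos_braid big_cons. Qed.

Lemma pos_braid_cat u v : pos_braid (u ++ v) = pos_braid u * pos_braid v.
Proof. by rewrite /pos_braid big_cat. Qed.

Lemma pos_braid_positive u : pos (pos_braid u).
Proof. by apply/positiveP; exists u. Qed.

(** The word length of a positive braid; the value 0 on other braids is a dummy. *)
Definition braid_length x : nat :=
  if pselect (exists u, `[< x = pos_braid u >]) is left ex then size (xchoose ex)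
  else 0.

Lemma braid_length_pos_braid u : braid_length (pos_braid u) = size u.
Proof.
rewrite /braid_length; case: pselect => [ex | []]; last by exists u; apply/asboolP.
by have /asboolP/pos_braid_eq/pos_congr_size := xchooseP ex.
Qed.

Lemma braid_lengthM x y : pos x -> pos y ->
  braid_length (x * y) = (braid_length x + braid_length y)%N.
Proof.
move=> /positiveP[u ->] /positiveP[v ->].
by rewrite -pos_braid_cat !braid_length_pos_braid size_cat.
Qed.

Lemma braid_length_sigma i : braid_length (sigma i) = 1%N.
Proof. by have := braid_length_pos_braid [:: i]; rewrite /pos_braid big_seq1. Qed.

Lemma positive_head x : pos x -> x = 1 \/ exists i y, pos y /\ x = sigma i * y.
Proof.
move=> /positiveP[[|i u] ->]; first by left; rewrite /pos_braid big_nil.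
right; exists i, (pos_braid u); split; first exact: pos_braid_positive.
exact: pos_braid_cons.
Qed.

Lemma positive_last x : pos x -> x = 1 \/ exists y i, pos y /\ x = y * sigma i.
Proof.
move=> /positiveP[u ->]; case/lastP: u => [|u i].
  by left; rewrite /pos_braid big_nil.
right; exists (pos_braid u), i; split; first exact: pos_braid_positive.
by rewrite -cats1 pos_braid_cat /pos_braid big_seq1.
Qed.

Lemma ldiv_refl x : ldiv x x.
Proof. by exists 1; [apply: Positive1 | rewrite mulg1]. Qed.

Lemma ldiv_mulr x y : pos y -> ldiv x (x * y).
Proof. by exists y. Qed.

Lemma ldiv1 x : pos x -> ldiv 1 x.
Proof. by exists x; rewrite ?mul1g. Qed.

Lemma ldiv_trans x y z : ldiv x y -> ldiv y z -> ldiv x z.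
Proof. by case=> a pa -> [b pb ->]; exists (a * b); [apply: PositiveM | rewrite mulgA]. Qed.

Lemma ldiv_mul2l a x y : ldiv (a * x) (a * y) <-> ldiv x y.
Proof.
split=> -[z pz]; first by rewrite -mulgA => /mulgI ->; exists z.
by move=> ->; exists z; rewrite ?mulgA.
Qed.

Definition sigma_compl i j : braid n :=
  if i == j then 1 else if far i j then sigma j else sigma j * sigma i.

Lemma sigma_compl_pos i j : pos (sigma_compl i j).
Proof.
rewrite /sigma_compl; case: ifP => _; first exact: Positive1.
by case: ifP => _; [|apply: PositiveM]; apply: PositiveSigma.
Qed.

Lemma sigma_complC i j : sigma i * sigma_compl i j = sigma j * sigma_compl j i.
Proof.
rewrite /sigma_compl; case: (genP i j) => [->|ij|ij].
- by rewrite eqxx.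
- by rewrite eq_sym far_neq // farC ij sigma_far.
by rewrite eq_sym near_neq // farC near_far // !mulgA sigma_near.
Qed.

(** Garside's lemma, transported to the group along the embedding. *)
Lemma sigma_lcm i j x :
  ldiv (sigma i) x -> ldiv (sigma j) x -> ldiv (sigma i * sigma_compl i j) x.
Proof.
move=> [y /positiveP[u ->] ->] [z /positiveP[v ->]].
rewrite ldiv_mul2l -!pos_braid_cons => /pos_braid_eq/bmon_ofP.
rewrite !bmon_of_cons => /gen_lcm[z' [uE _]].
have cE : exists w, gen_compl i j = bmon_of w /\ sigma_compl i j = pos_braid w.
  rewrite /gen_compl /sigma_compl; case: ifP => _.
    by exists [::]; rewrite /pos_braid big_nil.
  case: ifP => _; first by exists [:: j]; rewrite /pos_braid big_seq1.
  exists [:: j; i]; rewrite bmon_of_cons; split=> //.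
  by rewrite /pos_braid big_cons big_seq1.
case: cE uE => w [-> ->]; rewrite -(bmon_of_repr z') -bmon_of_cat.
move=> /bmon_ofP/pos_braid_eq ->; rewrite pos_braid_cat.
exact/ldiv_mulr/pos_braid_positive.
Qed.

(** Common left divisors of x and y form a directed set.  Having two bounds allows
    a common multiple of a and b to be kept inside Delta, hence simple, and inside
    another multiple of a and b at the same time.  The lcm of the first
    letters of a and b divides x and y; by induction on the length of x, one
    completes each side of the diamond and then closes it at the bottom. *)
Lemma ldiv_directed a b x y : pos a -> pos b ->
  ldiv a x -> ldiv b x -> ldiv a y -> ldiv b y ->
  exists l, [/\ ldiv a l, ldiv b l, ldiv l x & ldiv l y].
Proof.
have [L] := ubnP (braid_length x); elim: L => // L IHL in a b x y *.
rewrite ltnS => xL pa pb ax bx ay by_.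
have [a1 | [i [a' [pa' aE]]]] := positive_head pa.
  by exists b; split=> //; [rewrite a1; apply: ldiv1 | apply: ldiv_refl].
have [b1 | [j [b' [pb' bE]]]] := positive_head pb.
  by exists a; split=> //; [apply: ldiv_refl | rewrite b1; apply: ldiv1].
subst a b.
have lcm z : ldiv (sigma i * a') z -> ldiv (sigma j * b') z ->
    ldiv (sigma i * sigma_compl i j) z.
  move=> az bz; apply: sigma_lcm; first exact: ldiv_trans (ldiv_mulr _ pa') az.
  exact: ldiv_trans (ldiv_mulr _ pb') bz.
have [x' px' xE] := lcm _ ax bx; have [y' py' yE] := lcm _ ay by_.
have pci := sigma_compl_pos i j; have pcj := sigma_compl_pos j i.
have ps k := PositiveSigma k.
have xE' : x = sigma j * sigma_compl j i * x' by rewrite -sigma_complC.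
have yE' : y = sigma j * sigma_compl j i * y' by rewrite -sigma_complC.
have lx : braid_length x = (braid_length (sigma_compl i j * x')).+1.
  by rewrite xE -mulgA [LHS]braid_lengthM ?braid_length_sigma ?add1n //; apply: PositiveM.
have lx' : braid_length x = (braid_length (sigma_compl j i * x')).+1.
  by rewrite xE' -mulgA [LHS]braid_lengthM ?braid_length_sigma ?add1n //; apply: PositiveM.
have [|||||||l1 [al1 cl1 l1x l1y]] :=
  IHL a' (sigma_compl i j) (sigma_compl i j * x') (sigma_compl i j * y') => //.
- by rewrite -lx.
- by move: ax; rewrite xE -mulgA ldiv_mul2l.
- exact: ldiv_mulr.
- by move: ay; rewrite yE -mulgA ldiv_mul2l.
- exact: ldiv_mulr.
have [|||||||l2 [bl2 cl2 l2x l2y]] :=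
  IHL b' (sigma_compl j i) (sigma_compl j i * x') (sigma_compl j i * y') => //.
- by rewrite -lx'.
- by move: bx; rewrite xE' -mulgA ldiv_mul2l.
- exact: ldiv_mulr.
- by move: by_; rewrite yE' -mulgA ldiv_mul2l.
- exact: ldiv_mulr.
case: cl1 al1 l1x l1y => m1 pm1 -> al1 /ldiv_mul2l m1x /ldiv_mul2l m1y.
case: cl2 bl2 l2x l2y => m2 pm2 -> bl2 /ldiv_mul2l m2x /ldiv_mul2l m2y.
have [|||||||m [m1m m2m mx my]] := IHL m1 m2 x' y' => //.
  by move: xL; rewrite lx braid_lengthM //; lia.
exists (sigma i * sigma_compl i j * m); split.
- rewrite -mulgA ldiv_mul2l; apply: ldiv_trans al1 _; exact/ldiv_mul2l.
- rewrite sigma_complC -mulgA ldiv_mul2l; apply: ldiv_trans bl2 _; exact/ldiv_mul2l.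
- by rewrite xE ldiv_mul2l.
- by rewrite yE ldiv_mul2l.
Qed.

Lemma braid_congr_rev (p q : braid_word n) : braid_congr p q -> braid_congr (rev p) (rev q).
Proof.
elim=> {p q} [a b p q pq|p|p q _ /BraidSym//|p q r _ pq _ /(BraidTrans pq)//].
  rewrite !rev_cat -!catA; apply: BraidRel.
  case: pq => [i e|i j ij|i j ij]; rewrite /rev /=.
  - by rewrite -{2}[e]negbK; apply: BraidCancel.
  - by apply: BraidFar; rewrite orbC.
  exact: BraidNear.
exact: BraidRefl.
Qed.

(** The anti-automorphism that reads words backwards, without inverting letters: it
    fixes the generators and exchanges left and right divisors. *)
Definition braid_rev x : braid n := braid_of (rev (repr x)).

Lemma braid_rev_of (p : braid_word n) : braid_rev (braid_of p) = braid_of (rev p).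
Proof. by apply/braid_ofP/braid_congr_rev/braid_ofP; rewrite braid_of_repr. Qed.

Lemma braid_revM x y : braid_rev (x * y) = braid_rev y * braid_rev x.
Proof.
rewrite -(braid_of_repr x) -(braid_of_repr y) [_ * braid_of _]braid_mul_of.
by rewrite !braid_rev_of rev_cat [RHS]braid_mul_of.
Qed.

Lemma braid_revK : involutive braid_rev.
Proof. by move=> x; rewrite -(braid_of_repr x) !braid_rev_of revK. Qed.

Lemma braid_rev_sigma i : braid_rev (sigma i) = sigma i.
Proof. exact: braid_rev_of. Qed.

Lemma braid_rev_pos x : pos x -> pos (braid_rev x).
Proof.
elim=> [|i|y z _ py _ pz]; first by rewrite [braid_rev 1]braid_rev_of; apply: Positive1.
  by rewrite braid_rev_sigma; apply: PositiveSigma.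
by rewrite braid_revM; apply: PositiveM.
Qed.

Lemma ldiv_rev x y : ldiv (braid_rev x) (braid_rev y) <-> rdiv x y.
Proof.
split=> -[z /braid_rev_pos pz]; last by move=> ->; exists (braid_rev z); rewrite ?braid_revM.
by move=> /(congr1 braid_rev); rewrite braid_revM !braid_revK; exists (braid_rev z).
Qed.

Lemma rdiv_directed a b x y : pos a -> pos b ->
  rdiv a x -> rdiv b x -> rdiv a y -> rdiv b y ->
  exists l, [/\ rdiv a l, rdiv b l, rdiv l x & rdiv l y].
Proof.
move=> /braid_rev_pos pa /braid_rev_pos pb.
move=> /ldiv_rev ax /ldiv_rev bx /ldiv_rev ay /ldiv_rev by_.
have [l [al bl lx ly]] := ldiv_directed pa pb ax bx ay by_.
by exists (braid_rev l); split; apply/ldiv_rev; rewrite braid_revK.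
Qed.

End Divisibility.

(** * Crossing numbers of pairs of strands *)

Section Crossings.

Definition swap (i a : nat) : nat :=
  if a == i then i.+1 else if a == i.+1 then i else a.

(* Innermost tests are decided first, so that the value of an outer swap is known
   before it is compared. *)
Ltac swap_cases :=
  repeat match goal with |- context [?x == ?y] =>
    lazymatch x with
    | context [if _ then _ else _] => fail
    | _ => case: (x =P y) => ? /=; try (exfalso; lia)
    end
  end; try lia.

Lemma swapK i : involutive (swap i).
Proof. by move=> a; rewrite /swap; swap_cases. Qed.

Definition crosses (i a b : nat) : bool :=
  (a == i) && (b == i.+1) || (a == i.+1) && (b == i).

(** The number of times the strands starting at positions a and b cross in the
    positive word u.  It is invariant under the braid relations, at most 1 in the
    half twist, and at least 2 for the two strands involved in a square, which is how
    squares are excluded from Delta. *)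
Fixpoint crossings (u : seq nat) (a b : nat) : nat :=
  if u is i :: u' then (crosses i a b + crossings u' (swap i a) (swap i b))%N else 0%N.

Definition carry (u : seq nat) (a : nat) : nat := foldl (fun a i => swap i a) a u.

Lemma carry_cat u v a : carry (u ++ v) a = carry v (carry u a).
Proof. exact: foldl_cat. Qed.

Lemma carryK u a : carry u (carry (rev u) a) = a.
Proof.
elim: u a => [|i u IHu] a //; rewrite rev_cons -cats1 carry_cat /=.
by rewrite swapK IHu.
Qed.

Lemma crossings_cat u v a b :
  crossings (u ++ v) a b = (crossings u a b + crossings v (carry u a) (carry u b))%N.
Proof. by elim: u a b => [|i u IHu] a b //=; rewrite IHu addnA. Qed.

Lemma swap_eq i j a : i != j -> i != j.+1 -> (swap j a == i) = (a == i).
Proof. by rewrite /swap => /eqP ij /eqP ij'; swap_cases. Qed.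

Lemma carry_far i j a : far i j -> swap j (swap i a) = swap i (swap j a).
Proof. by rewrite /far /swap => ij; swap_cases. Qed.

Lemma crossings_far i j a b : far i j ->
  crossings [:: i; j] a b = crossings [:: j; i] a b.
Proof.
move=> ij; rewrite /= !addn0 addnC /crosses.
by congr (_ + _)%N; rewrite !swap_eq //; move: ij; rewrite /far; lia.
Qed.

Lemma swapL i : swap i i = i.+1. Proof. by rewrite /swap eqxx. Qed.
Lemma swapR i : swap i i.+1 = i. Proof. by rewrite -[in LHS]swapL swapK. Qed.

Variant pos_spec (i a : nat) : Prop :=
| Pos0 of a = i | Pos1 of a = i.+1 | Pos2 of a = i.+2
| PosOther of (a == i) = false & (a == i.+1) = false & (a == i.+2) = false.

Lemma posP i a : pos_spec i a.
Proof.
case: (eqVneq a i) => [|/negPf a0]; first exact: Pos0.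
case: (eqVneq a i.+1) => [|/negPf a1]; first exact: Pos1.
case: (eqVneq a i.+2) => [|/negPf a2]; first exact: Pos2.
exact: PosOther.
Qed.

Lemma crossings_nearS i a b :
  crossings [:: i; i.+1; i] a b = crossings [:: i.+1; i; i.+1] a b /\
  carry [:: i; i.+1; i] a = carry [:: i.+1; i; i.+1] a.
Proof.
have e1 : (i == i.+1) = false by lia.
have e2 : (i == i.+2) = false by lia.
have e3 : (i.+1 == i) = false by lia.
have e4 : (i.+2 == i) = false by lia.
have e5 : (i.+1 == i.+2) = false by lia.
have e6 : (i.+2 == i.+1) = false by lia.
rewrite /= /crosses /swap.
have [->|->|->|a0 a1 a2] := posP i a; have [->|->|->|b0 b1 b2] := posP i b.
all: by do !rewrite ?(a0, a1, a2) ?(b0, b1, b2) ?(e1, e2, e3, e4, e5, e6, eqxx) /=.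
Qed.

Lemma crossings_near i j a b : near i j ->
  crossings [:: i; j; i] a b = crossings [:: j; i; j] a b /\
  carry [:: i; j; i] a = carry [:: j; i; j] a.
Proof.
case/orP=> /eqP->; first exact: crossings_nearS.
by have [-> ->] := crossings_nearS j a b.
Qed.

Lemma pos_congr_crossings N (u v : seq 'I_N) : pos_congr u v ->
  forall a b, crossings (map val u) a b = crossings (map val v) a b /\
              carry (map val u) a = carry (map val v) a.
Proof.
elim=> {u v} [p q u v uv|//|u v _ IH|u v w _ IHu _ IHv] a b.
- rewrite !map_cat !crossings_cat !carry_cat.
  have uvE c d : crossings (map val u) c d = crossings (map val v) c d /\
              carry (map val u) c = carry (map val v) c.
    case: uv => i j ij; last exact: crossings_near.
    by rewrite (crossings_far _ _ ij) /= carry_far.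
  have [-> ->] := uvE (carry [seq val i | i <- p] a) (carry [seq val i | i <- p] b).
  by have [_ ->] := uvE (carry [seq val i | i <- p] b) a.
- by have [-> ->] := IH a b.
by have [-> ->] := IHu a b.
Qed.

Lemma crossings_square u v i :
  let a := carry (rev u) i in let b := carry (rev u) i.+1 in
  (2 <= crossings (u ++ [:: i; i] ++ v) a b)%N.
Proof.
rewrite /= crossings_cat !carryK /= swapL swapR /crosses !eqxx orbT; lia.
Qed.

Fixpoint twist_word m : seq nat := if m is k.+1 then iota 0 k ++ twist_word k else [::].

Lemma carry_iota s k a : carry (iota s k) a =
  if a == s then (s + k)%N else if (s < a <= s + k)%N then a.-1 else a.
Proof.
elim: k s a => [|k IHk] s a /=.
  by rewrite addn0; swap_cases; case: ifP => //; lia.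
by rewrite IHk /swap; swap_cases; repeat case: ifP => /=; try lia.
Qed.

Lemma crossings_iota s k a b : crossings (iota s k) a b =
  ((a == s) && (s < b <= s + k) || (b == s) && (s < a <= s + k))%N :> nat.
Proof.
elim: k s a b => [|k IHk] s a b /=; first by lia.
by rewrite IHk /crosses /swap; swap_cases.
Qed.

(** The strand starting at 0 crosses every other one once and then leaves the range
    of the remaining letters; the vanishing outside the range is what makes the
    induction work. *)
Lemma crossings_twist_word m a b :
  (crossings (twist_word m) a b <= ((a < m) && (b < m)))%N.
Proof.
elim: m a b => // m IHm a b /=; rewrite crossings_cat crossings_iota.
have := IHm (carry (iota 0 m) a) (carry (iota 0 m) b).
by rewrite !carry_iota !add0n; swap_cases; repeat case: ifP => /=; lia.
Qed.

End Crossings.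

(** * Simple braids *)

Section Garside.
Variable n : nat.
Hypothesis n_gt0 : 0 < n.
Local Notation N := n.-1.
Implicit Types (i j k : 'I_N) (x y z a b c l s h u v w : braid n).
Local Notation ldiv := (@left_divisor n).
Local Notation rdiv := (@right_divisor n).
Local Notation pos := (@positive n).
Local Notation Delta := (Delta n).

Definition sigma_nat (k : nat) : braid n := if insub k is Some i then sigma i else 1.

Lemma sigma_natE i : sigma_nat i = sigma i.
Proof. by rewrite /sigma_nat valK. Qed.

Lemma sigma_nat_far (k l : nat) :
  far k l -> sigma_nat k * sigma_nat l = sigma_nat l * sigma_nat k.
Proof.
move=> kl; rewrite /sigma_nat.
case: insubP => [i _ ik|_]; case: insubP => [j _ jl|_]; rewrite ?mul1g ?mulg1 //.
by apply: sigma_far; rewrite ik jl.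
Qed.

Lemma sigma_nat_near (k : nat) : (k.+1 < N)%N ->
  sigma_nat k * sigma_nat k.+1 * sigma_nat k =
  sigma_nat k.+1 * sigma_nat k * sigma_nat k.+1.
Proof.
move=> kN; have := @sigma_near n (Ordinal (ltnW kN)) (Ordinal kN).
by rewrite -!sigma_natE /= eqxx; apply.
Qed.

Definition sigma_word (k : nat) : seq 'I_N :=
  [seq i : 'I_N <- index_enum 'I_N | (i < k)%N].

Lemma sigma_wordE (k : nat) : (k <= N)%N -> map val (sigma_word k) = iota 0 k.
Proof.
move=> kN; have -> : map val (sigma_word k) = [seq m <- map val (enum 'I_N) | (m < k)%N].
  by rewrite filter_map /sigma_word /index_enum -enumT.
by rewrite val_enum_ord; apply: (@filter_iota_ltn 0).
Qed.

Lemma sigma_wordP (k : nat) : (k <= N)%N -> pos_braid (sigma_word k) = ascend sigma_nat k.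
Proof.
move=> kN; rewrite /pos_braid; under eq_bigr do rewrite -sigma_natE.
rewrite -(big_map val xpredT sigma_nat) sigma_wordE //.
rewrite -[k in iota _ k]subn0 -/(index_iota 0 k).
by elim: k {kN} => [|k IHk]; [rewrite big_nil | rewrite big_nat_recr // IHk].
Qed.

Fixpoint Delta_word (m : nat) : seq 'I_N :=
  if m is k.+1 then sigma_word k ++ Delta_word k else [::].

Lemma Delta_wordE : Delta = pos_braid (Delta_word n).
Proof.
rewrite /Delta; elim: (X in delta_rec _ X = pos_braid (Delta_word X)) => [|m IHm] /=.
  by rewrite /pos_braid big_nil.
by rewrite pos_braid_cat IHm /pos_braid big_filter.
Qed.

Lemma val_Delta_word m : (m <= n)%N -> map val (Delta_word m) = twist_word m.
Proof.
elim: m => //= m IHm mn; rewrite map_cat IHm 1?ltnW // sigma_wordE //; lia.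
Qed.

Lemma Delta_half_twist : Delta = half_twist sigma_nat N.+1.
Proof.
suff H m : (m <= n)%N -> pos_braid (Delta_word m) = half_twist sigma_nat m.
  by rewrite Delta_wordE prednK // H.
elim: m => [|m IHm] mn /=; first by rewrite /pos_braid big_nil.
rewrite pos_braid_cat sigma_wordP ?IHm //; lia.
Qed.

Lemma sigma_Delta i : sigma i * Delta = Delta * sigma (rev_ord i).
Proof.
rewrite Delta_half_twist -!sigma_natE.
by apply: (half_twist_flip sigma_nat_far sigma_nat_near) => //=; have := ltn_ord i; lia.
Qed.

Lemma Delta_conj x : pos x -> pos (Delta^-1 * x * Delta) /\ pos (Delta * x * Delta^-1).
Proof.
elim=> [|i|y z _ [y1 y2] _ [z1 z2]].
- by rewrite !mulg1 mulVg mulgV; split; apply: Positive1.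
- rewrite -mulgA sigma_Delta mulKg -{2}(rev_ordK i) -sigma_Delta mulgK.
  by split; apply: PositiveSigma.
have -> : Delta^-1 * (y * z) * Delta = Delta^-1 * y * Delta * (Delta^-1 * z * Delta).
  by rewrite !mulgA mulgK.
have -> : Delta * (y * z) * Delta^-1 = Delta * y * Delta^-1 * (Delta * z * Delta^-1).
  by rewrite !mulgA mulgVK.
by split; apply: PositiveM.
Qed.

(** If Delta = x * c, then Delta = (Delta * c * Delta^-1) * x, and conjugation by Delta
    permutes the generators, hence preserves positivity. *)
Lemma ldiv_rdiv_Delta x : ldiv x Delta <-> rdiv x Delta.
Proof.
split=> -[c /Delta_conj[c1 c2] DE].
  by exists (Delta * c * Delta^-1) => //; rewrite {3}DE invgM !mulgA mulgK mulgVK.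
by exists (Delta^-1 * c * Delta) => //; rewrite {2}DE invgM !mulgA mulgV mul1g mulVg mul1g.
Qed.

Lemma square_free x i : pos x -> ~ ldiv (x * sigma i * sigma i) Delta.
Proof.
move=> /positiveP[u ->] [_ /positiveP[v ->]].
have -> : pos_braid u * sigma i * sigma i = pos_braid (u ++ [:: i; i]).
  by rewrite pos_braid_cat /pos_braid !big_cons big_nil mulg1 mulgA.
rewrite Delta_wordE -pos_braid_cat => /pos_braid_eq/pos_congr_crossings H.
have := crossings_square (map val u) (map val v) i.
set a := carry _ _; set b := carry _ _.
have [] := H a b; rewrite !map_cat -catA val_Delta_word //= => <- _.
by have := crossings_twist_word n a b; case: (_ && _); lia.
Qed.

Lemma sigma_ldiv_Delta i : ldiv (sigma i) Delta.
Proof.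
have iN : (i.+1 < N.+1)%N by rewrite ltnS.
rewrite Delta_half_twist -sigma_natE.
apply: (half_twist_gen sigma_nat_far sigma_nat_near (P := pos)) => //.
- exact: Positive1.
- move=> k; rewrite /sigma_nat; case: insubP => *; [exact: PositiveSigma|exact: Positive1].
- by move=> x y px py; apply: PositiveM.
Qed.

Lemma mul_sigma_lcm s i j : ldiv (s * sigma i) Delta -> ldiv (s * sigma j) Delta ->
  ldiv (s * (sigma i * sigma_compl i j)) Delta.
Proof.
by rewrite -{1 2 3}(mulVKg s Delta) !ldiv_mul2l; apply: sigma_lcm.
Qed.

(** The exchange property, by induction on the length of s.  Let sigma j be the last
    letter of s, and remove from s its longest suffix in the two letters i and j.
    By induction, what remains is either extended inside Delta by both letters,
    hence by their lcm, or the suffix is long enough for a braid relation to bring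
    sigma i to the end. *)
Lemma exchange s i : pos s -> ldiv s Delta -> ldiv (s * sigma i) Delta \/ rdiv (sigma i) s.
Proof.
have ps := @PositiveSigma n.
have [L] := ubnP (braid_length s); elim: L => // L IHL in s i *.
rewrite ltnS => sL s_pos sD.
have [->|[s1 [j [s1_pos sE]]]] := positive_last s_pos.
  by left; rewrite mul1g; apply: sigma_ldiv_Delta.
have s1L : (braid_length s1 < L)%N.
  by move: sL; rewrite sE braid_lengthM // braid_length_sigma addn1.
have s1D : ldiv s1 Delta by apply: ldiv_trans sD; rewrite sE; apply: ldiv_mulr.
have IH1 := IHL s1 i s1L s1_pos s1D.
case: (genP i j) => [->|ij|ij]; first by right; rewrite sE; exists s1.
  case: IH1 => [s1i | [s2 s2_pos s1E]]; [left | right].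
    have := mul_sigma_lcm (j := j) s1i; rewrite -sE => /(_ sD).
    by rewrite /sigma_compl far_neq // ij sE sigma_far // !mulgA.
  exists (s2 * sigma j); first exact: PositiveM.
  by rewrite sE s1E -!mulgA sigma_far.
have compl_ij : sigma_compl i j = sigma j * sigma i.
  by rewrite /sigma_compl near_neq // near_far.
case: IH1 => [s1i | [s2 s2_pos s1E]].
  left; have := mul_sigma_lcm (j := j) s1i; rewrite -sE => /(_ sD).
  rewrite compl_ij mulgA -[_ * _ * _]mulgA [sigma i * _]mulgA sigma_near // sE.
  by apply: ldiv_trans; rewrite !mulgA; apply: ldiv_mulr.
have s2i : ldiv (s2 * sigma i) Delta by rewrite -s1E.
have s2L : (braid_length s2 < L)%N.
  by move: s1L; rewrite s1E braid_lengthM // braid_length_sigma; lia.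
have s2D : ldiv s2 Delta by apply: ldiv_trans s2i; apply: ldiv_mulr.
case: (IHL s2 j s2L s2_pos s2D) => [s2j | [s3 s3_pos s2E]]; [left | right].
  by have := mul_sigma_lcm s2i s2j; rewrite compl_ij sE s1E !mulgA.
exists (s3 * sigma i * sigma j); first by do 2?[apply: PositiveM].
by rewrite sE s1E s2E -!mulgA; congr (_ * _); rewrite !mulgA sigma_near // /near orbC.
Qed.

Definition greedy a b := forall i, ldiv (sigma i) b -> rdiv (sigma i) a.

Lemma simple_right_factor x y : pos x -> pos y -> simple (x * y) -> simple y.
Proof.
move=> px py [_ [z pz DE]]; split=> //.
apply: ldiv_trans (ldiv_mulr _ pz) _; apply/ldiv_rdiv_Delta.
by exists x; rewrite // mulgA.
Qed.

Lemma simple_right_square x i : pos x -> rdiv (sigma i) x -> ~ ldiv (x * sigma i) Delta.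
Proof. by move=> px [y py ->]; apply: square_free. Qed.

(** The normality condition, which only speaks of atoms, makes a the largest simple
    left divisor of a * b: if a common upper bound of s and a were larger than a,
    it would extend a by an atom that begins b, and so ends a, producing a square
    inside Delta. *)
Lemma greedy_head a b s : simple a -> greedy a b -> simple s ->
  ldiv s (a * b) -> pos b -> ldiv s a.
Proof.
move=> [pa aD] ab [ps sD] sab pb.
have [l [sl [c pc lE] lD lab]] := ldiv_directed ps pa sD aD sab (ldiv_mulr _ pb).
have [c1 | [i [c' [pc' cE]]]] := positive_head pc; first by rewrite lE c1 mulg1 in sl.
have ai : ldiv (a * sigma i) l by exists c'; rewrite // lE cE mulgA.
case: (@simple_right_square a i) => //; last exact: ldiv_trans ai lD.
by apply: ab; apply/(ldiv_mul2l a); apply: ldiv_trans ai lab.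
Qed.

(** Greediness persists after left multiplication by a simple braid: some common
    multiple of s and x divides both Delta and x * (a * b); its cofactor over x is
    simple, and [greedy_head] applies to it. *)
Lemma greedy_mull a b x s : simple x -> simple a -> greedy a b -> simple s -> pos b ->
  ldiv s (x * (a * b)) -> ldiv s (x * a).
Proof.
move=> [px xD] sa ab [ps sD] pb sxab; have [pa _] := sa.
have xxab : ldiv x (x * (a * b)) by apply/ldiv_mulr/PositiveM.
have [l [sl [c pc lE] lD lab]] := ldiv_directed ps px sD xD sxab xxab.
apply: ldiv_trans sl _; rewrite lE; apply/ldiv_mul2l; apply: greedy_head ab _ _ pb => //.
  by apply: (simple_right_factor px) => //; split; [apply: PositiveM | rewrite -lE].
by apply/(ldiv_mul2l x); rewrite -lE.
Qed.

(** * The two domino rules *)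

(** The labels form two tiles side by side:
<<
        a'     b'
      +----->+----->
    x |     y|     z|
      v  a   v  b   v
      +----->+----->
>>
    If an atom sigma begins b' and a' * sigma is simple, then a' * sigma divides
    a' * b' * z = x * a * b, hence x * a = a' * y by [greedy_mull], so sigma
    begins y and therefore ends a'; the other case of [exchange] is the claim. *)
Lemma domino_row x a b a' b' y z :
  simple x -> simple a -> simple b -> simple a' -> simple b' -> simple y -> simple z ->
  a' * y = x * a -> b' * z = y * b -> greedy a' y -> greedy a b -> greedy a' b'.
Proof.
move=> sx sa [pb _] [pa' a'D] [pb' _] [py _] [pz _] ay bz ga gab i ib'.
case: (exchange i pa' a'D) => // a'i; apply: ga.
apply/(ldiv_mul2l a'); rewrite ay; apply: greedy_mull gab _ pb _ => //.
  by split=> //; apply: PositiveM => //; apply: PositiveSigma.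
rewrite mulgA -ay -mulgA -bz ldiv_mul2l.
exact: ldiv_trans ib' (ldiv_mulr _ pz).
Qed.

(** As u and v have no common left divisor, x = u * a = v * b is a left lcm of a and
    b; hence x * sigma i is one of a * sigma i and b * sigma i, and divides Delta
    on the right as soon as they do. *)
Lemma rdiv_lcm_sigma x a b u v i : pos a -> pos b -> pos u -> pos v ->
  x = u * a -> x = v * b -> (forall j, ldiv (sigma j) u -> ~ ldiv (sigma j) v) ->
  rdiv (a * sigma i) Delta -> rdiv (b * sigma i) Delta -> rdiv (x * sigma i) Delta.
Proof.
move=> pa pb pu pv xa xb coprime_uv [z pz za] [z' pz' zb].
have ax : rdiv a x by exists u.
have bx : rdiv b x by exists v.
have az : rdiv a (z * a) by exists z.
have bz : rdiv b (z * a).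
  by exists z' => //; apply: (@mulIg _ (sigma i)); rewrite -!mulgA -za.
have [l [[c pc la] [d pd lb] [e pe xl] [f pf zl]]] := rdiv_directed pa pb ax bx az bz.
have [e1 | [j [e' [pe' eE]]]] := positive_head pe.
  by exists f; rewrite // xl e1 mul1g mulgA -zl -mulgA.
have uE : u = sigma j * (e' * c).
  by apply: (@mulIg _ a); rewrite -xa xl eE la !mulgA.
have vE : v = sigma j * (e' * d).
  by apply: (@mulIg _ b); rewrite -xb xl eE lb !mulgA.
case: (coprime_uv j); first by rewrite uE; apply/ldiv_mulr/PositiveM.
by rewrite vE; apply/ldiv_mulr/PositiveM.
Qed.

(** The labels form two tiles on top of each other:
<<
          h0
       +----->
    v1 |      | w1
       v  h1  v
       +----->
    v2 |      | w2
       v  h2  v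
       +----->
>>
    Suppose that an atom sigma begins w2 and that w1 * sigma is simple.  Being the
    largest simple left divisors of their tiles, h0 and h1 are multiples of v1
    and v2: h0 = v1 * u and h1 = v2 * k = u * w1.  Then k * sigma is simple, since
    it divides h2 = k * w2, and u and v2 are coprime, since v1 * u is simple and
    every atom of v2 ends v1.  So h1 * sigma is simple by [rdiv_lcm_sigma],
    although h1 ends with sigma because the lower tile is normal. *)
Lemma domino_column v1 v2 h0 h1 h2 w1 w2 :
  simple v1 -> simple v2 -> simple h0 -> simple h1 -> simple h2 -> simple w1 ->
  simple w2 -> h0 * w1 = v1 * h1 -> h1 * w2 = v2 * h2 ->
  greedy h0 w1 -> greedy h1 w2 -> greedy v1 v2 -> greedy w1 w2.
Proof.
move=> sv1 sv2 sh0 sh1 sh2 sw1 sw2 E1 E2 g0 g1 gv i iw2.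
have [[pv1 v1D] [pv2 v2D] [ph0 h0D] [ph1 h1D]] := And4 sv1 sv2 sh0 sh1.
have [[ph2 h2D] [pw1 w1D] [pw2 w2D]] := And3 sh2 sw1 sw2.
have psi := PositiveSigma i.
case: (exchange i pw1 w1D) => // w1i; exfalso.
have [|k pk h1k] := greedy_head sh1 g1 sv2 _ pw2; first by rewrite E2; apply: ldiv_mulr.
have h2k : h2 = k * w2 by apply: (mulgI v2); rewrite -E2 h1k mulgA.
have [|u pu h0u] := greedy_head sh0 g0 sv1 _ pw1; first by rewrite E1; apply: ldiv_mulr.
have h1u : h1 = u * w1 by apply: (mulgI v1); rewrite -E1 h0u mulgA.
case: (@simple_right_square h1 i) => //; first exact: g1.
apply/ldiv_rdiv_Delta; apply: (rdiv_lcm_sigma pk pw1 pv2 pu) => //.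
- move=> j jv2 ju; case: (@simple_right_square v1 j) => //; first exact: gv.
  by apply: ldiv_trans h0D; rewrite h0u ldiv_mul2l.
- by apply/ldiv_rdiv_Delta; apply: ldiv_trans h2D; rewrite h2k ldiv_mul2l.
exact/ldiv_rdiv_Delta.
Qed.

End Garside.

(** * Grids of P-tiles *)

Section Grid.
Variables (n p q : nat) (s t : seq (braid n)) (h v : nat -> nat -> braid n).
Hypothesis n_gt0 : 0 < n.
Hypotheses (s_normal : normal s) (t_normal : normal t) (grid : P_grid p q s t h v).

Lemma size_hpath j i0 i1 : size (hpath h j i0 i1) = (i1 - i0)%N.
Proof. by rewrite size_map size_iota subSS. Qed.

Lemma size_vpath i j0 j1 : size (vpath v i j0 j1) = (j1 - j0)%N.
Proof. by rewrite size_map size_iota subSS. Qed.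

Lemma nth_hpath j i0 i1 k : (k < i1 - i0)%N -> nth 1 (hpath h j i0 i1) k = h (i0 + k).+1 j.
Proof.
move=> k_lt; rewrite (nth_map 0%N) ?size_iota ?subSS //.
by rewrite nth_iota ?subSS // addSn.
Qed.

Lemma nth_vpath i j0 j1 k : (k < j1 - j0)%N -> nth 1 (vpath v i j0 j1) k = v i (j0 + k).+1.
Proof.
move=> k_lt; rewrite (nth_map 0%N) ?size_iota ?subSS //.
by rewrite nth_iota ?subSS // addSn.
Qed.

Lemma tile_greedy i j : (1 <= i <= p)%N -> (1 <= j <= q)%N -> greedy (h i j.-1) (v i j).
Proof. by move=> ip jq; have [_ [_ /(_ 0%N isT)]] := P_grid_tile grid ip jq. Qed.

Lemma tile_eq i j : (1 <= i <= p)%N -> (1 <= j <= q)%N ->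
  h i j.-1 * v i j = v i.-1 j * h i j.
Proof. by move=> ip jq; case: (P_grid_tile grid ip jq). Qed.

Lemma row_greedy i j : (1 <= i)%N -> (i < p)%N -> (j <= q)%N -> greedy (h i j) (h i.+1 j).
Proof.
move=> i_gt0 ip; have [d] := ubnP (q - j); elim: d => // d IHd in j *; rewrite ltnS => jd.
rewrite leq_eqVlt => /predU1P[-> | jq].
  move: s_normal; rewrite -(P_grid_bottom grid) => -[_ /(_ i.-1)].
  rewrite size_hpath prednK // subn0 => /(_ ip).
  by rewrite !nth_hpath ?add0n ?prednK //; lia.
have i1p : (1 <= i.+1 <= p)%N by [].
have i0p : (1 <= i <= p)%N by rewrite i_gt0 ltnW.
have j1q : (1 <= j.+1 <= q)%N by [].
have hs := P_grid_hsimple grid; have vs := P_grid_vsimple grid.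
have IH : greedy (h i j.+1) (h i.+1 j.+1) by apply: IHd; lia.
apply: (domino_row n_gt0 _ _ _ _ _ _ _ (tile_eq i0p j1q) (tile_eq i1p j1q)
                   (tile_greedy i0p j1q) IH).
all: by [apply: hs; lia | apply: vs; lia].
Qed.

Lemma column_greedy i j : (i <= p)%N -> (1 <= j)%N -> (j < q)%N -> greedy (v i j) (v i j.+1).
Proof.
move=> ip j_gt0 jq; elim: i ip => [_ | i IHi ip].
  move: t_normal; rewrite -(P_grid_left grid) => -[_ /(_ j.-1)].
  rewrite size_vpath prednK // subn0 => /(_ jq).
  by rewrite !nth_vpath ?add0n ?prednK //; lia.
have i1p : (1 <= i.+1 <= p)%N by [].
have j0q : (1 <= j <= q)%N by rewrite j_gt0 ltnW.
have j1q : (1 <= j.+1 <= q)%N by [].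
have hs := P_grid_hsimple grid; have vs := P_grid_vsimple grid.
apply: (domino_column n_gt0 _ _ _ _ _ _ _ (tile_eq i1p j0q) (tile_eq i1p j1q)
                   (tile_greedy i1p j0q) (tile_greedy i1p j1q) (IHi (ltnW ip))).
all: by [apply: hs; lia | apply: vs; lia].
Qed.

Lemma path_normal i0 i1 j0 j1 : (i0 <= i1 <= p)%N -> (j0 <= j1 <= q)%N ->
  normal (hpath h j0 i0 i1 ++ vpath v i1 j0 j1).
Proof.
move=> i01 j01; split=> [x | k].
  rewrite mem_cat => /orP[] /mapP[m]; rewrite mem_index_iota => mi ->.
    by apply: (P_grid_hsimple grid); lia.
  by apply: (P_grid_vsimple grid); lia.
rewrite size_cat size_hpath size_vpath !nth_cat size_hpath => k_lt.
case: (ltnP k.+1 (i1 - i0)) => ki1.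
  rewrite ifT; last exact: ltnW.
  rewrite !nth_hpath //; last exact: ltnW.
  by rewrite addnS; apply: row_greedy; lia.
case: (ltnP k (i1 - i0)) => ki0; rewrite ?nth_hpath ?nth_vpath //; try lia.
  (* The corner of the path, where the last horizontal arrow meets the first
     vertical one. *)
  have -> : (i0 + k).+1 = i1 by lia.
  have -> : (j0 + (k.+1 - (i1 - i0))).+1 = j0.+1 by lia.
  by apply: (@tile_greedy _ j0.+1); lia.
have -> : (j0 + (k.+1 - (i1 - i0))).+1 = (j0 + (k - (i1 - i0))).+2 by lia.
by apply: column_greedy; lia.
Qed.

Lemma prod_hpathS i j :
  \prod_(z <- hpath h j 0 i.+1) z = \prod_(z <- hpath h j 0 i) z * h i.+1 j.
Proof. by rewrite !big_map big_nat_recr. Qed.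

Lemma prod_vpathS i j :
  \prod_(z <- vpath v i 0 j.+1) z = \prod_(z <- vpath v i 0 j) z * v i j.+1.
Proof. by rewrite !big_map big_nat_recr. Qed.

Lemma column_push i j : (i < p)%N -> (j <= q)%N ->
  \prod_(z <- vpath v i 0 j) z * h i.+1 j = h i.+1 0 * \prod_(z <- vpath v i.+1 0 j) z.
Proof.
move=> ip; elim: j => [|j IHj] jq; first by rewrite !big_nil mul1g mulg1.
rewrite !prod_vpathS -mulgA -(@tile_eq i.+1 j.+1) //=.
by rewrite !mulgA IHj // ltnW.
Qed.

Lemma grid_prod i j : (i <= p)%N -> (j <= q)%N ->
  \prod_(z <- vpath v 0 0 j) z * \prod_(z <- hpath h j 0 i) z =
  \prod_(z <- hpath h 0 0 i) z * \prod_(z <- vpath v i 0 j) z.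
Proof.
move=> ip jq; elim: i ip => [|i IHi] ip; first by rewrite !big_nil mul1g mulg1.
by rewrite !prod_hpathS mulgA IHi 1?ltnW // -!mulgA column_push.
Qed.

End Grid.

Theorem proposition2p13 (n p q : nat) (s : p.-tuple (braid n)) (t : q.-tuple (braid n))
    (h v : nat -> nat -> braid n) :
  (2 <= n)%N ->
  normal s -> normal t ->
  P_grid p q s t h v ->
  (forall i0 i1 j0 j1 : nat, (i0 <= i1 <= p)%N -> (j0 <= j1 <= q)%N ->
     normal (hpath h j0 i0 i1 ++ vpath v i1 j0 j1)) /\
  (forall x y : braid n, x = \prod_(z <- s) z -> y = \prod_(z <- t) z ->
     normal_form (hpath h 0 0 p ++ vpath v p 0 q) (y * x)).
Proof.
move=> n_ge2 s_normal t_normal grid; have n_gt0 : 0 < n by apply: ltnW.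
have paths := path_normal n_gt0 s_normal t_normal grid; split=> // x y -> ->.
split; first by apply: paths; rewrite leqnn.
by rewrite -(P_grid_bottom grid) -(P_grid_left grid) big_cat; apply: (grid_prod grid).
Qed.
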